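(* Fix a prompt $q$ and let $\pi_{\mathrm{old}}(\cdot|q)$ and $\pi_\theta(\cdot|q)$ be policies. Let $p=\mathbb{P}_{o\sim\pi_{\mathrm{old}}(\cdot|q)}(r(q,o)=1)$ and let $\epsilon\in[0,1]$ be the clipping parameter. (1) Suppose $0<p<1$, and let $A(q,o)=\dfrac{r(q,o)-p}{\sqrt{p(1-p)}}$ be the whitened reward. Then $$\mathbb{E}_{o\sim\pi_{\mathrm{old}}(\cdot|q)} f_\epsilon\!\left(\frac{\pi_\theta(o|q)}{\pi_{\mathrm{old}}(o|q)},A(q,o)\right)=\sqrt{\frac{1-p}{p}}\;\mathbb{E}_{o\sim\pi_{\mathrm{old}}(\cdot|q)}\!\left[\min\!\left(\frac{\pi_\theta(o|q)}{\pi_{\mathrm{old}}(o|q)},1+\epsilon\right)\mathbf{1}_{r(q,o)=1}\right]-\sqrt{\frac{p}{1-p}}\;\mathbb{E}_{o\sim\pi_{\mathrm{old}}(\cdot|q)}\!\left[\max\!\left(\frac{\pi_\theta(o|q)}{\pi_{\mathrm{old}}(o|q)},1-\epsilon\right)\mathbf{1}_{r(q,o)=0}\right].$$ (2) Let $\varepsilon\in(0,1]$ be a smoothing factor (and $p\in[0,1]$ arbitrary), and let $A_\varepsilon(q,o)=\dfrac{r(q,o)-p}{\sqrt{p(1-p)+\varepsilon}}$. Then $$\mathbb{E}_{o\sim\pi_{\mathrm{old}}(\cdot|q)} f_\epsilon\!\left(\frac{\pi_\theta(o|q)}{\pi_{\mathrm{old}}(o|q)},A_\varepsilon(q,o)\right)=\omega^+_\varepsilon(p)\,\mathbb{E}_{o\sim\pi_{\mathrm{old}}(\cdot|q)}\!\left[\min\!\left(\frac{\pi_\theta(o|q)}{\pi_{\mathrm{old}}(o|q)},1+\epsilon\right)\mathbf{1}_{r(q,o)=1}\right]-\omega^-_\varepsilon(p)\,\mathbb{E}_{o\sim\pi_{\mathrm{old}}(\cdot|q)}\!\left[\max\!\left(\frac{\pi_\theta(o|q)}{\pi_{\mathrm{old}}(o|q)},1-\epsilon\right)\mathbf{1}_{r(q,o)=0}\right],$$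 where $\omega^+_{\varepsilon}(p)=\dfrac{1-p}{\sqrt{p(1-p)+\varepsilon}}$ and $\omega^-_{\varepsilon}(p)=\dfrac{p}{\sqrt{p(1-p)+\varepsilon}}$.
   Context: $\mathcal{O}$ is the space of outcomes (sequences); a policy $\pi(\cdot|q)$ is a probability density on $\mathcal{O}$ with respect to a fixed $\sigma$-finite base measure (counting measure when $\mathcal{O}$ is countable). The reward $r$ is verifiable, i.e. binary: $r(q,o)\in\{0,1\}$ (measurable in $o$). The clipping function is $f_\epsilon(x,y)=\min\big(xy,\ \mathrm{clip}(x,1-\epsilon,1+\epsilon)\,y\big)$, where $\mathrm{clip}(x,a,b)=\min(\max(x,a),b)$. *)

(* Defs.v *)
From HB Require Import structures.
From mathcomp Require Import all_boot all_order all_algebra.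
From mathcomp Require Import all_classical all_reals all_analysis.
From mathcomp Require Import measurable_realfun.
Set Implicit Arguments.
Unset Strict Implicit.
Unset Printing Implicit Defensive.
Import Order.TTheory GRing.Theory Num.Theory.
Import numFieldNormedType.Exports.
Local Open Scope classical_set_scope.
Local Open Scope ring_scope.

Record density d (O : measurableType d) (R : realType)
    (mu : {measure set O -> \bar R}) := Density {
  density_fun :> O -> R;
  measurable_density : measurable_fun [set: O] density_fun;
  density_ge0 : forall o, 0 <= density_fun o;
  integral_density : (\int[mu]_o (density_fun o)%:E = 1)%E }.

Definition density_prob d (O : measurableType d) (R : realType)
    (mu : {measure set O -> \bar R}) (f : density mu) (A : set O) : \bar R :=
  (\int[mu]_(o in A) (f o)%:E)%E.

Section density_prob.
Context d (O : measurableType d) (R : realType).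
Context (mu : {measure set O -> \bar R}) (f : density mu).
Local Open Scope ereal_scope.

Let density_prob0 : density_prob f set0 = 0.
Proof. by rewrite /density_prob integral_set0. Qed.

Let density_prob_ge0 A : 0 <= density_prob f A.
Proof. by apply: integral_ge0 => o _; rewrite lee_fin density_ge0. Qed.

Let density_prob_sigma_additive : semi_sigma_additive (density_prob f).
Proof.
apply: semi_sigma_additive_nng_induced.
- by apply/measurable_EFinP; exact: measurable_density.
- by move=> o; rewrite lee_fin density_ge0.
Qed.

HB.instance Definition _ := isMeasure.Build _ _ _ (density_prob f)
  density_prob0 density_prob_ge0 density_prob_sigma_additive.

Let density_prob_setT : density_prob f [set: O] = 1.
Proof. exact: integral_density. Qed.

HB.instance Definition _ :=
  @Measure_isProbability.Build _ _ R (density_prob f) density_prob_setT.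

End density_prob.

Definition clip (R : realType) (x a b : R) : R := Num.min (Num.max x a) b.

Definition clip_obj (R : realType) (eps x y : R) : R :=
  Num.min (x * y) (clip x (1 - eps) (1 + eps) * y).

(* The quotient is 0 where the denominator vanishes (x / 0 = 0), which is a
   null set for [density_prob (pi_old q)]. *)
Definition likelihood_ratio d (O : measurableType d) (R : realType)
    (mu : {measure set O -> \bar R}) (Q : Type)
    (pi_theta pi_old : Q -> density mu) (q : Q) (o : O) : R :=
  pi_theta q o / pi_old q o.

Definition success_prob d (O : measurableType d) (R : realType)
    (mu : {measure set O -> \bar R}) (Q : Type)
    (pi_old : Q -> density mu) (r : Q -> O -> R) (q : Q) : R :=
  fine (density_prob (pi_old q) [set o | r q o = 1]).

Definition advantage (O : Type) (R : realType) (Q : Type)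
    (r : Q -> O -> R) (p : R) (q : Q) (o : O) : R :=
  (r q o - p) / Num.sqrt (p * (1 - p)).

Definition smoothed_advantage (O : Type) (R : realType) (Q : Type)
    (delta : R) (r : Q -> O -> R) (p : R) (q : Q) (o : O) : R :=
  (r q o - p) / Num.sqrt (p * (1 - p) + delta).

Definition omega_plus (R : realType) (delta p : R) : R :=
  (1 - p) / Num.sqrt (p * (1 - p) + delta).

Definition omega_minus (R : realType) (delta p : R) : R :=
  p / Num.sqrt (p * (1 - p) + delta).

(* Main.v *)
Require Import Defs.
From HB Require Import structures.
From mathcomp Require Import all_boot all_order all_algebra.
From mathcomp Require Import all_classical all_reals all_analysis.
From mathcomp Require Import measurable_realfun ring lra.
Import Order.TTheory GRing.Theory Num.Theory.
Import numFieldNormedType.Exports.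
Local Open Scope classical_set_scope.
Local Open Scope ring_scope.

(* A real-valued [X] always has ['E[X] = 'E[X^+] - 'E[X^-]], by definition of
   the integral: the two terms of the decomposition are nonnegative with
   disjoint supports, so they are the positive and negative parts of the
   objective. *)

Section clip_obj.
Context (R : realType).
Implicit Types (eps x y : R).

(** A factor [y >= 0] comes out of the minimum; the lower clip is then absorbed because
    [min x (max x (1 - eps)) = x]. *)
Lemma clip_obj_ge0 eps x y : 0 <= eps -> 0 <= y ->
  clip_obj eps x y = y * Num.min x (1 + eps).
Proof.
move=> eps0 y0; rewrite /clip_obj ![_ * y]mulrC -minr_pMr// /clip; congr (_ * _).
by rewrite minA; congr Num.min; apply/min_idPl; rewrite le_max lexx.
Qed.

(** Pulling out a factor [y <= 0] turns the minimum into a maximum, so now the upper clip is the one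
    absorbed. *)
Lemma clip_obj_le0 eps x y : 0 <= eps -> y <= 0 ->
  clip_obj eps x y = y * Num.max x (1 - eps).
Proof.
move=> eps0 y0; rewrite /clip_obj ![_ * y]mulrC -maxr_nMr// /clip; congr (_ * _).
have [xe|ex] := leP x (1 - eps).
  (* Here the clip equals [1 - eps], since [1 - eps <= 1 + eps] by [eps0]. *)
  by rewrite (min_idPl _) ?(max_idPr _)//; lra.
by rewrite (max_idPl _)// ge_min lexx.
Qed.

End clip_obj.

(** Inversion is continuous on the open set of nonzero reals, and the singleton of [0] is treated
    separately. *)
Lemma measurable_invr (R : realType) :
  measurable_fun [set: R] (fun x : R => x^-1).
Proof.
rewrite -(setvU [set (0 : R)]); apply/measurable_funU => //.
  exact: measurableC.
split; last exact: measurable_fun_set1.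
apply: open_continuous_measurable_fun.
  by rewrite openC; exact: closed_eq.
by move=> x; rewrite inE => /eqP x0; exact: inv_continuous.
Qed.

Section expectation.
Context d (O : measurableType d) (R : realType) (P : probability O R).
Implicit Types (X Y rho A : O -> R) (S : set O).

(** Nonnegativity takes the place of integrability, so the expectations of the truncated ratios need
    not be shown finite. *)
Lemma ge0_expectationZl X (k : R) : measurable_fun [set: O] X ->
  (forall o, 0 <= X o) -> 0 <= k ->
  ('E_P[(fun o => k * X o)%R] = k%:E * 'E_P[X])%E.
Proof.
move=> mX X0 k0; rewrite unlock; under eq_integral do rewrite EFinM.
by rewrite ge0_integralZl//; [exact/measurable_EFinP | move=> o _; rewrite lee_fin].
Qed.

(** The vanishing product encodes disjoint supports: at each point, whichever of [X o] and [Y o]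
    survives is the matching part of [X o - Y o]. *)
Lemma expectationB_disjoint X Y : (forall o, 0 <= X o) -> (forall o, 0 <= Y o) ->
  (forall o, X o * Y o = 0) -> ('E_P[(fun o => X o - Y o)%R] = 'E_P[X] - 'E_P[Y])%E.
Proof.
move=> X0 Y0 XY; rewrite unlock integralE; congr (_ - _)%E;
  apply: eq_integral => o _; rewrite (funeposE, funenegE) -?EFinN -EFin_max;
  congr EFin; have /eqP := XY o; rewrite mulf_eq0 => /orP[] /eqP ->;
  have := X0 o; have := Y0 o => ? ?; rewrite ?maxEle; case: ifP; lra.
Qed.

(** Common core of both claims, which differ only in the two values [a] and [- b] taken by the
    advantage on and off the success event. *)
Lemma expectation_clip_obj S rho A (a b eps : R) :
  measurable S -> measurable_fun [set: O] rho -> (forall o, 0 <= rho o) ->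
  0 <= a -> 0 <= b -> 0 <= eps <= 1 ->
  (forall o, S o -> A o = a) -> (forall o, ~ S o -> A o = - b) ->
  ('E_P[(fun o => clip_obj eps (rho o) (A o))%R] =
   a%:E * 'E_P[(fun o => Num.min (rho o) (1 + eps) * \1_S o)%R] -
   b%:E * 'E_P[(fun o => Num.max (rho o) (1 - eps) * \1_(~` S) o)%R])%E.
Proof.
move=> mS mrho rho0 a0 b0 /andP[eps0 eps1] Aa Ab.
have min0 o : 0 <= Num.min (rho o) (1 + eps) * \1_S o.
  by rewrite mulr_ge0// le_min rho0 addr_ge0.
have max0 o : 0 <= Num.max (rho o) (1 - eps) * \1_(~` S) o.
  by rewrite mulr_ge0// le_max rho0.
rewrite -!ge0_expectationZl//; first last.
- apply: measurable_funM; last exact: measurable_indic.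
  exact: measurable_minr.
- apply: measurable_funM; last by apply: measurable_indic; exact: measurableC.
  exact: measurable_maxr.
rewrite -expectationB_disjoint.
(* Pointwise, one indicator vanishes and the sign of [A o] selects the applicable formula for
   [clip_obj]. *)
- congr expectation; apply/funext => o; rewrite !indicE in_setC.
  have [/set_mem So|/negP nSo] := boolP (o \in S).
    by rewrite (Aa _ So) clip_obj_ge0//= mulr0 mulr1 mulr0 subr0.
  rewrite Ab; last by move=> So; apply: nSo; rewrite inE.
  by rewrite clip_obj_le0 ?oppr_le0//= mulr0 mulr1 mulr0 sub0r mulNr.
- by move=> o; rewrite mulr_ge0.
- by move=> o; rewrite mulr_ge0.
- by move=> o; rewrite !indicE in_setC; case: (o \in S); rewrite /= ?(mulr0, mul0r).
Qed.

End expectation.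

Section density.
Context d (O : measurableType d) (R : realType)
  (mu : {measure set O -> \bar R}) (Q : Type).

Lemma likelihood_ratio_ge0 (pi_theta pi_old : Q -> density mu) q o :
  0 <= likelihood_ratio pi_theta pi_old q o.
Proof. by rewrite divr_ge0// density_ge0. Qed.

Lemma measurable_likelihood_ratio (pi_theta pi_old : Q -> density mu) q :
  measurable_fun [set: O] (likelihood_ratio pi_theta pi_old q).
Proof.
apply: measurable_funM; first exact: measurable_density.
apply: (measurableT_comp (@measurable_invr R)); exact: measurable_density.
Qed.

Lemma success_prob_itv (pi_old : Q -> density mu) r q :
  measurable [set o | r q o = 1] -> 0 <= success_prob pi_old r q <= 1.
Proof.
move=> mS; pose P : probability O R := density_prob (pi_old q).
rewrite /success_prob fine_ge0 ?(measure_ge0 P)//=.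
by rewrite -lee_fin fineK ?(fin_num_measure P)// (probability_le1 P).
Qed.

End density.

Theorem mainTheorem1
    (R : realType) (d : measure_display) (O : measurableType d)
    (mu : {sigma_finite_measure set O -> \bar R})
    (Q : Type) (r : Q -> O -> R)
    (r_binary : forall q o, r q o = 0 \/ r q o = 1)
    (r_meas : forall q, measurable_fun [set: O] (r q))
    (pi_old pi_theta : Q -> density mu)
    (q : Q) (eps : R) (eps_ge0 : 0 <= eps) (eps_le1 : eps <= 1) :
  let P : probability O R := density_prob (pi_old q) in
  let p := success_prob pi_old r q in
  let rho := likelihood_ratio pi_theta pi_old q in
  (0 < p -> p < 1 ->
   ('E_P[(fun o => clip_obj eps (rho o) (advantage r p q o))%R] =
    (Num.sqrt ((1 - p) / p))%R%:E *
      'E_P[(fun o => Num.min (rho o) (1 + eps) * \1_[set o' | r q o' = 1] o)%R]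
    - (Num.sqrt (p / (1 - p)))%R%:E *
      'E_P[(fun o => Num.max (rho o) (1 - eps) * \1_[set o' | r q o' = 0] o)%R])%E)
  /\
  (forall delta : R, 0 < delta -> delta <= 1 ->
   ('E_P[(fun o => clip_obj eps (rho o) (smoothed_advantage delta r p q o))%R] =
    (omega_plus delta p)%:E *
      'E_P[(fun o => Num.min (rho o) (1 + eps) * \1_[set o' | r q o' = 1] o)%R]
    - (omega_minus delta p)%:E *
      'E_P[(fun o => Num.max (rho o) (1 - eps) * \1_[set o' | r q o' = 0] o)%R])%E).
Proof.
move=> P p rho.
have mS : measurable [set o | r q o = 1].
  by rewrite -[X in measurable X]setTI; exact: (r_meas q measurableT [set 1]).
(* Binarity of [r] turns the failure event into the complement of the success event. *)
have -> : [set o | r q o = 0] = ~` [set o | r q o = 1].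
  apply/seteqP; split=> o /=; first by move=> ->; apply/eqP; rewrite eq_sym oner_eq0.
  by have [|] := r_binary q o.
have /andP[p0 p1] : 0 <= p <= 1 by exact: success_prob_itv.
have rS o : ~ r q o = 1 -> r q o = 0 by have [|] := r_binary q o.
have eps01 : 0 <= eps <= 1 by rewrite eps_ge0.
have mrho : measurable_fun [set: O] rho by exact: measurable_likelihood_ratio.
have rho0 o : 0 <= rho o by exact: likelihood_ratio_ge0.
split=> [p_gt0 p_lt1|delta delta0 delta1].
(* The strict bounds on [p] make both square roots nonzero, so they can be cancelled. *)
- have q_gt0 : 0 < 1 - p by rewrite subr_gt0.
  have sp0 : Num.sqrt p != 0 by rewrite sqrtr_eq0 -ltNge.
  have sq0 : Num.sqrt (1 - p) != 0 by rewrite sqrtr_eq0 -ltNge.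
  apply: expectation_clip_obj => //.
  + move=> o; rewrite /advantage => ->.
    (* Writing the numerator [1 - p] as the square of its root lets one root cancel against the
       denominator. *)
    rewrite !sqrtrM ?sqrtrV// 1?ltW// -{1}(sqr_sqrtr (ltW q_gt0)).
    by field; rewrite sp0 sq0.
  + move=> o /rS; rewrite /advantage => ->.
    rewrite sub0r !sqrtrM ?sqrtrV// 1?ltW// -{1}(sqr_sqrtr p0).
    by field; rewrite sp0 sq0.
(* With smoothing, [omega_plus] and [omega_minus] are by definition the two advantage values up to
   sign, so no root is cancelled and [p] may be [0] or [1]. *)
- apply: expectation_clip_obj => //.
  + by rewrite divr_ge0// subr_ge0.
  + by rewrite divr_ge0.
  + by move=> o; rewrite /smoothed_advantage => ->.
  + by move=> o /rS; rewrite /smoothed_advantage => ->; rewrite sub0r mulNr.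
Qed.
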